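(* Let $n\ge 1$ be an integer, let $p$ be a prime, and let $P_n=\left(\binom{i-1}{j-1}\right)_{1\le i,j\le n}$ be the $n\times n$ lower triangular Pascal matrix. Then the Jordan form of $P_n$ mod $p$ (that is, of $P_n$ regarded as a matrix over the field $\mathbb{F}_p$) has precisely $\lceil n/p\rceil$ Jordan blocks, all corresponding to the eigenvalue $1$, and $\lfloor n/p\rfloor$ of them are of size $p$.
   Context: A binomial coefficient $\binom{a}{b}$ with integers $0\le a<b$ is zero, so $P_n$ is lower triangular with ones on the diagonal. A Jordan block of size $m$ with eigenvalue $\lambda$ is here the $m\times m$ matrix with $\lambda$ on the diagonal, $1$ on the subdiagonal, and $0$ elsewhere (using the superdiagonal instead gives a similar matrix). *)

(* Defs.v *)
From HB Require Import structures.
From mathcomp Require Import all_boot all_order all_algebra.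
Set Implicit Arguments.
Unset Strict Implicit.
Unset Printing Implicit Defensive.
Import Order.TTheory GRing.Theory Num.Theory.
Local Open Scope ring_scope.

(* Rows and columns are numbered from 0, hence no shift in the binomial. *)
Definition pascal (n : nat) : 'M[int]_n :=
  \matrix_(i < n, j < n) ('C(i, j))%:Z.

Definition pascal_mod (p n : nat) : 'M['F_p]_n :=
  map_mx (fun z : int => z%:~R) (pascal n).

Definition jordan_block (F : fieldType) (m : nat) (lambda : F) : 'M[F]_m :=
  \matrix_(i < m, j < m)
    (if i == j then lambda else if (i : nat) == j.+1 then 1 else 0).

(* The k-th pair (m, lambda) of s gives the size and the eigenvalue of the
   k-th diagonal block. *)
Definition jordan_mx (F : fieldType) (s : seq (nat * F)) :
    'M[F]_(\sum_(k < size s) (tnth (in_tuple s) k).1) :=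
  \mxdiag_(k < size s)
    jordan_block (tnth (in_tuple s) k).1 (tnth (in_tuple s) k).2.

(* Blocks of size 0 are excluded, since otherwise the number of blocks would
   not be determined by A.  The blocks may come in any order. *)
Definition jordan_form (F : fieldType) (n : nat) (A : 'M[F]_n)
    (s : seq (nat * F)) : Prop :=
  all (fun b => 0 < b.1)%N s /\
  exists e : (\sum_(k < size s) (tnth (in_tuple s) k).1)%N = n,
    A ~_{in unitmx} castmx (e, e) (jordan_mx s).

(* Main.v *)
Require Import Defs.
From HB Require Import structures.
From mathcomp Require Import all_boot all_order all_algebra.
Import Order.TTheory GRing.Theory Num.Theory.
Local Open Scope ring_scope.

(** Row [i] of the Pascal matrix holds the coefficients of [(1 + x) ^ i], so that
    the matrix acts on polynomials of degree less than [n] by [f(x) -> f(x + 1)].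
    Since [w = x ^ p - x] is invariant under this translation modulo [p], the
    polynomials [w ^ k * binomial(x, j)], with [j < p] and [k p + j < n], form a
    basis in which, for each fixed [k], the difference operator lowers [j] by one:
    this is a Jordan basis with blocks of size [p] and one of size [n mod p].
    Any other Jordan form has the same ranks of powers of [P - 1]: the power [p]
    forces the eigenvalue [1] and sizes at most [p], the power [1] gives the
    number of blocks and the power [p - 1] the number of blocks of size [p]. *)

(** * Jordan matrices: ranks of powers, and construction from chains *)

Lemma mulmx_expr_intertwine (F : fieldType) (m n : nat) (A : 'M[F]_n)
    (J : 'M[F]_m) (B : 'M[F]_(m, n)) (k : nat) :
  B *m A = J *m B -> B *m (A ^+ k) = J ^+ k *m B.
Proof.
move=> BA; elim: k => [|k IHk]; first by rewrite !expr0 mulmx1 mul1mx.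
by rewrite [A ^+ _]exprS [J ^+ _]exprS -!mulmxE mulmxA BA -!mulmxA IHk.
Qed.

Lemma mxdiag_expr (F : fieldType) (q : nat) (p_ : 'I_q -> nat)
    (D : forall i, 'M[F]_(p_ i)) (k : nat) :
  (\mxdiag_i D i) ^+ k = \mxdiag_i (D i ^+ k).
Proof.
elim: k => [|k IHk]; first by rewrite expr0 -[1]/(1%:M) -mxdiagZ.
rewrite exprS IHk -mulmxE [X in _ *m X]/mxdiag mul_mxdiag_mxblock.
apply/eq_mxblockP => i j; case: eqP => [<-|_]; last by rewrite mulmx0.
by rewrite !conform_mx_id exprS.
Qed.

(** For [m = n] this is the [k]-th power of the nilpotent Jordan block. The rectangular form allows
    rows and columns to be split differently when its rank is computed. *)
Definition shift_mx (F : fieldType) (k m n : nat) : 'M[F]_(m, n) :=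
  \matrix_(i < m, j < n) ((i : nat) == j + k)%N%:R.

Lemma rank_shift_mx (F : fieldType) (k m : nat) :
  \rank (shift_mx F k m m) = (m - k)%N.
Proof.
(* Splitting rows as [k + d] and columns as [d + k] isolates an identity block of size [d] in the
   lower left corner. *)
have gen d a b : a = (k + d)%N -> b = (d + k)%N ->
    \rank (shift_mx F k a b) = d.
  move=> -> ->.
  have ->: shift_mx F k (k + d) (d + k) = block_mx 0 0 1%:M 0.
    rewrite -[LHS]submxK; congr block_mx; apply/matrixP=> i j; rewrite !mxE /=.
    - by rewrite ltn_eqF // (leq_trans (ltn_ord i)) ?leq_addl.
    - by rewrite ltn_eqF // (leq_trans (ltn_ord i)) ?leq_addl.
    - by rewrite addnC eqn_add2r.
    - rewrite addnC eqn_add2r ltn_eqF //.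
      by rewrite (leq_trans (ltn_ord i)) ?leq_addr.
  by rewrite block_mxEv row_mx0 rank_col_0mx rank_row_mx0 mxrank1.
have [km|mk] := leqP k m.
  by apply: gen; rewrite ?subnKC ?subnK.
suff ->: shift_mx F k m m = 0 by rewrite mxrank0; apply/esym/eqP; rewrite subn_eq0 ltnW.
apply/matrixP=> i j; rewrite !mxE ltn_eqF //.
by rewrite (leq_trans (ltn_ord i)) // (leq_trans (ltnW mk)) ?leq_addl.
Qed.

Lemma jordan_blockE (F : fieldType) (m : nat) (c : F) :
  jordan_block m c = c%:M + shift_mx F 1 m m.
Proof.
apply/matrixP=> i j; rewrite !mxE addn1 -(inj_eq val_inj) /=.
case: eqP => [->|_]; first by rewrite ltn_eqF // addr0.
by rewrite add0r; case: ifP.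
Qed.

Lemma shift_mx_expr (F : fieldType) (k m : nat) :
  shift_mx F 1 m m ^+ k = shift_mx F k m m.
Proof.
elim: k => [|k IHk].
  by apply/matrixP=> i j; rewrite expr0 !mxE addn0.
rewrite exprSr IHk; apply/matrixP=> i j; rewrite !mxE.
have [ltjm|lemj] := ltnP j.+1 m; last first.
  rewrite big1 ?ltn_eqF //.
    by rewrite (leq_trans (ltn_ord i)) // (leq_trans lemj) // addnS ltnS leq_addr.
  move=> l _; rewrite !mxE addn1 [(l == j.+1 :> nat)%N]ltn_eqF ?mulr0 //.
  by rewrite (leq_trans (ltn_ord l)).
rewrite (bigD1 (Ordinal ltjm)) //= big1 ?addr0 => [|l /negPf nl].
  by rewrite !mxE /= addn1 eqxx mulr1 addnS addSn.
by rewrite !mxE addn1 -[X in _ == X.+1]/(val j) -(inj_eq val_inj) /= in nl *; rewrite nl mulr0.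
Qed.

Lemma rank_jordan_block_expr (F : fieldType) (m k : nat) (c : F) :
  \rank ((jordan_block m c - c%:M) ^+ k) = (m - k)%N.
Proof. by rewrite jordan_blockE addrC addKr shift_mx_expr rank_shift_mx. Qed.

(** The matrix is triangular with the nonzero constant [a - c] on its diagonal, hence invertible. *)
Lemma rank_jordan_block_expr_neq (F : fieldType) (m k : nat) (a c : F) :
  a != c -> \rank ((jordan_block m a - c%:M) ^+ k) = m.
Proof.
move=> ac; have free : row_free (jordan_block m a - c%:M).
  rewrite row_free_unit unitmxE det_trig.
    rewrite unitfE; apply/prodf_neq0 => i _.
    by rewrite !mxE !eqxx mulr1n subr_eq0.
  apply/is_trig_mxP=> i j ij; rewrite !mxE -!(inj_eq val_inj) /= !ltn_eqF //.
    by rewrite subrr.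
  exact: ltnW.
elim: k => [|k IHk]; first by rewrite expr0 mxrank1.
by rewrite exprSr -mulmxE mxrankMfree.
Qed.

(** Similarity preserves ranks of powers, and ranks of diagonal blocks add up. The sum on the right
    is therefore the same for every Jordan form of [A]. *)
Lemma rank_jordan_form (F : fieldType) (n k : nat) (A : 'M[F]_n)
    (s : seq (nat * F)) (c : F) : jordan_form A s ->
  \rank ((A - c%:M) ^+ k)
    = (\sum_(b <- s) \rank ((jordan_block b.1 b.2 - c%:M) ^+ k))%N.
Proof.
case=> _ [e [B uB /(similarP uB)]].
case: _ / e A B uB => A B uB; rewrite castmx_id => BA.
have /(@mulmx_expr_intertwine _ _ _ _ _ _ k) BAk :
    B *m (A - c%:M) = (jordan_mx s - c%:M) *m B.
  by rewrite mulmxBr mulmxBl BA scalar_mxC.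
transitivity (\rank (B *m (A - c%:M) ^+ k)).
  by rewrite (eqmxMfull _ _) ?row_full_unit.
rewrite BAk mxrankMfree ?row_free_unit // big_tnth -rank_mxdiag -mxdiag_expr.
by rewrite mxdiagB mxdiagZ.
Qed.

Lemma jordan_form_sum (F : fieldType) (n : nat) (A : 'M[F]_n)
    (s : seq (nat * F)) : jordan_form A s -> (\sum_(b <- s) b.1)%N = n.
Proof. by case=> _ [e _]; rewrite big_tnth. Qed.

(** The chains [v k], stacked as rows, form the change of basis. [B] only serves to show that they
    span, so it may list the chain vectors in any order. *)
Lemma jordan_form_chains (F : fieldType) (n : nat) (A : 'M[F]_n)
    (s : seq (nat * F)) (v : nat -> nat -> 'rV[F]_n) (B : 'M[F]_n) (b0 : nat * F) :
  all (fun b => 0 < b.1)%N s -> (\sum_(b <- s) b.1)%N = n ->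
  (forall k j, (k < size s)%N -> (j < (nth b0 s k).1)%N ->
     v k j *m A = (nth b0 s k).2 *: v k j + (if j is j'.+1 then v k j' else 0)) ->
  B \in unitmx ->
  (forall i, exists k j,
     [/\ (k < size s)%N, (j < (nth b0 s k).1)%N & row i B = v k j]) ->
  jordan_form A s.
Proof.
move=> s_gt0 sum_s vA uB rowB; split=> //.
pose V (k : 'I_(size s)) : 'M[F]_((tnth (in_tuple s) k).1, n) :=
  \matrix_(j < (tnth (in_tuple s) k).1) v k j.
have e : (\sum_(k < size s) (tnth (in_tuple s) k).1)%N = n by rewrite -sum_s [RHS]big_tnth.
have nthk (k : 'I_(size s)) : nth b0 s k = tnth (in_tuple s) k.
  by rewrite (tnth_nth b0).
have full : row_full (\mxcol_k V k).
  rewrite -sub1mx (eqmx_col V) -(mulVmx uB).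
  apply: submx_trans (submxMl _ _) _; apply/row_subP=> i.
  have [k [j [ltk ltj ->]]] := rowB i.
  rewrite -[k]/(val (Ordinal ltk)) nthk in ltj.
  apply: (sumsmx_sup (Ordinal ltk)) => //; rewrite genmxE.
  by apply: (eq_row_sub (Ordinal ltj)); apply/rowP=> l; rewrite !mxE.
have VA : (\mxcol_k V k) *m A = jordan_mx s *m (\mxcol_k V k).
  rewrite mul_mxdiag_mxcol; apply/row_matrixP => i.
  (* Row [i] of the stack is vector number [j] of chain [k]. *)
  rewrite row_mul !row_mxcol; move: (tagnat.sig1 i) (tagnat.sig2 i) => k j.
  have rowV l : row l (V k) = v k l by apply/rowP=> m; rewrite !mxE.
  rewrite rowV vA ?nthk // jordan_blockE mulmxDl mul_scalar_mx !linearD !linearZ /=.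
  rewrite rowV row_mul; congr (_ + _).
  rewrite mulmx_sum_row; case: j => [[|j] ltj] /=.
    by rewrite big1 // => l _; rewrite !mxE addn1 scale0r.
  rewrite (bigD1 (Ordinal (ltnW ltj))) //= big1 ?addr0 => [|l /negPf nl].
    by rewrite rowV !mxE addn1 eqxx scale1r.
  by rewrite !mxE addn1 eqSS eq_sym -(inj_eq val_inj) /= in nl *; rewrite nl scale0r.
(* Forgetting everything else tied to [n] lets [e] be eliminated, which removes the cast. *)
exists e; clear - full VA; move: (\mxcol_k V k) (jordan_mx s) full VA.
case: _ / e A => A W J full WA; rewrite castmx_id.
by exists W; [rewrite -row_full_unit | apply/similarP; rewrite // -row_full_unit].
Qed.

(** * Translation of polynomials modulo [p] and its Jordan chains *)

Lemma poly_rV_mul_pascal (p n : nat) (f : {poly 'F_p}) : (size f <= n)%N ->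
  poly_rV f *m pascal_mod p n = poly_rV (f \Po ('X + 1)) :> 'rV_n.
Proof.
move=> fn; apply/rowP=> j; rewrite !mxE.
have f_sum : f = \sum_(i < n) f`_i *: 'X^i.
  rewrite -(poly_def n (fun i => f`_i)); apply/polyP=> i; rewrite coef_poly.
  by case: ltnP => // ni; rewrite nth_default // (leq_trans fn).
rewrite [in RHS]f_sum raddf_sum coef_sum /=; apply: eq_bigr => i _.
rewrite !mxE comp_polyZ coefZ comp_Xn_poly exprD1n coef_sum; congr (_ * _).
rewrite -pmulrn; have [ij|ji] := ltnP i j.
  rewrite bin_small // big1 // => l _.
  by rewrite coefMn coefXn gtn_eqF ?mul0rn // (leq_trans (ltn_ord l)).
rewrite (bigD1 (Ordinal (ji : (j < i.+1)%N))) //= big1 ?addr0 => [|l nl].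
  by rewrite coefMn coefXn eqxx.
by rewrite coefMn coefXn eq_sym -(inj_eq val_inj) /= in nl *; rewrite (negPf nl) mul0rn.
Qed.

Definition falling_poly (R : comNzRingType) (j : nat) : {poly R} :=
  \prod_(i < j) ('X - i%:R%:P).

Lemma size_falling_poly (R : comNzRingType) (j : nat) :
  size (falling_poly R j) = j.+1.
Proof. by rewrite size_prod_XsubC -[index_enum _]enumT size_enum_ord. Qed.

(** Both sides are multiples of [falling_poly R j], with cofactors [X + 1] and
    [(X - j) + (j + 1)]. *)
Lemma falling_poly_shift (R : comNzRingType) (j : nat) :
  falling_poly R j.+1 \Po ('X + 1)
    = falling_poly R j.+1 + j.+1%:R *: falling_poly R j.
Proof.
have -> : falling_poly R j.+1 \Po ('X + 1) = ('X + 1) * falling_poly R j.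
  rewrite /falling_poly big_ord_recl rmorphM rmorph_prod /=.
  rewrite comp_polyB comp_polyX comp_polyC subr0; congr (_ * _).
  apply: eq_bigr => i _; rewrite comp_polyB comp_polyX comp_polyC.
  by rewrite /bump /= add1n -addn1 natrD polyCD opprD addrACA subrr addr0.
rewrite {2}/falling_poly big_ord_recr /= -/(falling_poly R j).
rewrite -mul_polyC [falling_poly R j * _]mulrC -mulrDl; congr (_ * _).
by rewrite -addn1 natrD polyCD addrA subrK.
Qed.

(** In characteristic [p], [(X + 1) ^ p = X ^ p + 1], and the two ones cancel. *)
Lemma artin_schreier_shift (p : nat) : prime p ->
  ('X^p - 'X : {poly 'F_p}) \Po ('X + 1) = 'X^p - 'X.
Proof.
move=> pp; rewrite comp_polyB comp_Xn_poly comp_polyX exprDn_pchar.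
  by rewrite expr1n opprD addrACA subrr addr0.
by rewrite pnatE // (rmorph_pchar (@polyC _)) ?pchar_Fp.
Qed.

(* The divided power [falling_poly j / j`!] makes the forward difference a
   shift of the index [j]. *)
Definition chain_poly (p k j : nat) : {poly 'F_p} :=
  ('X^p - 'X) ^+ k * (j`!%:R^-1 *: falling_poly _ j).

Lemma fact_Fp_neq0 (p j : nat) : prime p -> (j < p)%N -> j`!%:R != 0 :> 'F_p.
Proof.
move=> pp jp; rewrite -(dvdn_pcharf (pchar_Fp pp)).
elim: j jp => [|j IHj] jp; first by rewrite dvdn1 gtn_eqF ?prime_gt1.
by rewrite factS Euclid_dvdM // negb_or IHj ?(ltnW jp) // andbT gtnNdvd.
Qed.

(** By Euclidean division each degree [k * p + j] occurs for exactly one pair with [j < p], so the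
    chain polynomials are linearly independent. *)
Lemma size_chain_poly (p k j : nat) : prime p -> (j < p)%N ->
  size (chain_poly p k j) = (k * p + j).+1.
Proof.
move=> pp jp.
have size_w : size ('X^p - 'X : {poly 'F_p}) = p.+1.
  by rewrite size_polyDl size_polyXn // size_polyN size_polyX ltnS prime_gt1.
have w0 : ('X^p - 'X : {poly 'F_p}) != 0 by rewrite -size_poly_gt0 size_w.
rewrite size_mul ?expf_neq0 //; last first.
  rewrite -size_poly_gt0 size_scale ?invr_eq0 ?fact_Fp_neq0 //.
  by rewrite size_falling_poly.
rewrite size_scale ?invr_eq0 ?fact_Fp_neq0 // size_falling_poly addnS /=.
by rewrite -(prednK (_ : 0 < size _)%N) ?size_poly_gt0 ?expf_neq0 // size_exp size_w /= mulnC.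
Qed.

Lemma chain_poly_shift (p k j : nat) : prime p -> (j < p)%N ->
  chain_poly p k j \Po ('X + 1)
    = chain_poly p k j + (if j is j'.+1 then chain_poly p k j' else 0).
Proof.
move=> pp jp; rewrite /chain_poly comp_polyM rmorphXn /= artin_schreier_shift //.
rewrite comp_polyZ; case: j jp => [|j] jp.
  by rewrite addr0 /falling_poly big_ord0 comp_polyC.
rewrite falling_poly_shift scalerDr mulrDr; congr (_ + _ * _).
rewrite scalerA; congr (_ *: _).
rewrite factS natrM invfM mulrAC mulVf ?mul1r //.
by rewrite -(dvdn_pcharf (pchar_Fp pp)) gtnNdvd.
Qed.

Lemma pascal_mod_jordan_form (n p : nat) : prime p ->
  jordan_form (pascal_mod p n)
    (nseq (n %/ p)%N (p, 1) ++ nseq (0 < n %% p)%N ((n %% p)%N, 1)).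
Proof.
move=> pp; have p_gt0 := prime_gt0 pp; set s := _ ++ _.
pose b0 : nat * 'F_p := (0%N, 0).
(* The chain polynomials selected by the block sizes have degree less than [n], so they fit into row
   vectors of length [n]. *)
have nth_s k j : (k < size s)%N -> (j < (nth b0 s k).1)%N ->
    [/\ (j < p)%N, (k * p + j < n)%N & (nth b0 s k).2 = 1].
  rewrite size_cat !size_nseq nth_cat size_nseq.
  have [kq _|qk] := ltnP k (n %/ p)%N.
    rewrite nth_nseq kq /= => jp; split=> //.
    rewrite (leq_trans _ (leq_divM n p)) // (@leq_trans (k.+1 * p)%N) //.
      by rewrite mulSnr ltn_add2l.
    by rewrite leq_mul2r kq orbT.
  rewrite nth_nseq => kq; rewrite ltn_subLR // kq /= => jr.
  split=> //; first exact: ltn_trans jr (ltn_pmod _ _).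
  rewrite (divn_eq n p).
  suff -> : k = (n %/ p)%N by rewrite ltn_add2l.
  apply/eqP; rewrite eqn_leq qk andbT -ltnS (leq_trans kq) //.
  by rewrite -[X in (_ <= X)%N]addn1 leq_add2l leq_b1.
(* Row [i] is the chain polynomial of degree [i]: [B] is triangular with leading coefficients on the
   diagonal. *)
pose B : 'M['F_p]_n := \matrix_(i < n) poly_rV (chain_poly p (i %/ p)%N (i %% p)%N).
have size_B (i : 'I_n) : size (chain_poly p (i %/ p)%N (i %% p)%N) = i.+1.
  by rewrite size_chain_poly ?ltn_pmod // -divn_eq.
apply: (@jordan_form_chains _ _ _ _ (fun k j => poly_rV (chain_poly p k j)) B b0).
- by rewrite all_cat !all_nseq /= p_gt0 orbT; case: (n %% p)%N.
- rewrite big_cat !big_nseq /= !iter_addn_0 [RHS](divn_eq n p) mulnC.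
  by case: (n %% p)%N => [|r]; rewrite ?mul0n ?muln1.
- move=> k j ks js; have [jp kpj ->] := nth_s k j ks js.
  rewrite poly_rV_mul_pascal ?size_chain_poly // chain_poly_shift // scale1r linearD.
  by case: j {js jp kpj} => [|j] //=; rewrite linear0.
- rewrite unitmxE det_trig.
    rewrite unitfE; apply/prodf_neq0 => i _; rewrite !mxE.
    by have := lead_coef_eq0 (chain_poly p (i %/ p)%N (i %% p)%N);
       rewrite /lead_coef size_B -size_poly_eq0 size_B /= => ->.
  by apply/is_trig_mxP=> i j ij; rewrite !mxE nth_default // size_B.
- move=> i; exists (i %/ p)%N, (i %% p)%N; rewrite rowK.
  rewrite size_cat !size_nseq nth_cat size_nseq.
  have [iq|qi] := ltnP (i %/ p)%N (n %/ p)%N.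
    by rewrite nth_nseq iq ltn_pmod // (leq_trans iq) ?leq_addr.
  have iqE : (i %/ p = n %/ p)%N.
    by apply/eqP; rewrite eqn_leq qi leq_div2r // ltnW.
  have ir : (i %% p < n %% p)%N.
    have := ltn_ord i; rewrite {1}(divn_eq i p) [X in (_ < X)%N -> _](divn_eq n p).
    by rewrite iqE ltn_add2l.
  by rewrite iqE subnn (leq_ltn_trans _ ir) //= addn1.
Qed.

(** * Block counts recovered from ranks *)

Lemma rank_pascal_mod (n p k : nat) : prime p ->
  \rank ((pascal_mod p n - 1%:M) ^+ k)
    = (n %/ p * (p - k) + (n %% p - k))%N.
Proof.
move=> /pascal_mod_jordan_form/rank_jordan_form->.
rewrite big_cat !big_nseq /= !iter_addn_0 !rank_jordan_block_expr mulnC.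
by case: (n %% p)%N => [|r]; rewrite ?mul0n ?muln1.
Qed.

Theorem theorem1 (n p : nat) (hn : (1 <= n)%N) (hp : prime p) :
  (exists s : seq (nat * 'F_p), jordan_form (pascal_mod p n) s) /\
  (forall s : seq (nat * 'F_p), jordan_form (pascal_mod p n) s ->
     [/\ (size s)%:Z = Num.ceil (n%:R / p%:R : rat),
         all (fun b => b.2 == 1) s
       & (count (fun b => b.1 == p) s)%:Z = Num.floor (n%:R / p%:R : rat)]).
Proof.
have p_gt0 := prime_gt0 hp.
split=> [|s sJ]; first by eexists; apply: pascal_mod_jordan_form.
have rk k : (\sum_(b <- s) \rank ((jordan_block b.1 b.2 - 1%:M) ^+ k)
    = n %/ p * (p - k) + (n %% p - k))%N.
  by rewrite -rank_pascal_mod // (rank_jordan_form _ _ _ _ s).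
have ltrp : (n %% p < p)%N by rewrite ltn_pmod.
have s_gt0 b : b \in s -> (0 < b.1)%N by case: sJ => /allP s_gt0 _ /s_gt0.
have rk0 b : b \in s -> \rank ((jordan_block b.1 b.2 - 1%:M) ^+ p) = 0%N.
  have /eqP := rk p; rewrite subnn muln0 add0n (eqP (ltnW ltrp : _ - _ == 0)%N).
  by rewrite sum_nat_seq_eq0 => /allP s0 /s0/eqP.
(* A block with another eigenvalue would keep its full positive rank in the power [p]. *)
have s1 b : b \in s -> b.2 = 1.
  move=> bs; apply/eqP/negP=> /negP b1.
  by have := s_gt0 b bs; have := rk0 b bs; rewrite rank_jordan_block_expr_neq // => ->.
have {}rk0 b : b \in s -> (b.1 <= p)%N.
  by move=> bs; have := rk0 b bs; rewrite s1 // rank_jordan_block_expr => /eqP.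
have {}rk k : (\sum_(b <- s) (b.1 - k) = n %/ p * (p - k) + (n %% p - k))%N.
  rewrite -rk; apply: eq_big_seq => b bs.
  by rewrite s1 // rank_jordan_block_expr.
(* Take [k = 1]: each block loses one from its positive size, so the number of blocks is [n] minus
   the rank. *)
have size_s : size s = (n %/ p + (0 < n %% p))%N.
  apply: (@addIn (\sum_(b <- s) (b.1 - 1))%N).
  rewrite -[X in (X + _)%N]sum1_size -big_split /=.
  under eq_big_seq => b bs do rewrite subnKC ?s_gt0 //.
  rewrite (jordan_form_sum _ _ _ _ sJ) rk {1}(divn_eq n p).
  rewrite addnACA -mulnS !subn1 prednK //.
  by case: (n %% p)%N => // r.
(* Take [k = p - 1]: as sizes are at most [p], the truncated difference [b.1 - (p - 1)] is 1 for
   size [p] and 0 otherwise. *)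
have count_s : count (fun b => b.1 == p) s = (n %/ p)%N.
  have p_sub : (p - p.-1 = 1)%N by rewrite -{1}(prednK p_gt0) subSnn.
  have := rk p.-1; rewrite p_sub muln1.
  have -> : (n %% p - p.-1 = 0)%N by apply/eqP; rewrite subn_eq0 -ltnS prednK.
  rewrite addn0 => <-; rewrite -sum1_count big_mkcond /=.
  apply: eq_big_seq => b bs; have := rk0 b bs; rewrite leq_eqVlt.
  case: eqP => [-> _|_ /=]; first by rewrite p_sub.
  by move=> bp; apply/esym/eqP; rewrite subn_eq0 -ltnS prednK.
have p0 : 0 < p%:R :> rat by rewrite ltr0n.
split.
- rewrite size_s; apply/esym/ceil_def.
  (* Once denominators are cleared and [n %/ p * p] is cancelled, only the remainder has to be
     bounded, by cases on whether it is zero. *)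
  rewrite ltr_pdivlMr // ler_pdivrMr // intrB -!pmulrn.
  rewrite mulrBl mul1r ltrBlDr -natrM -natrD ltr_nat ler_nat {3 4}(divn_eq n p).
  rewrite mulnDl -!addnA ltn_add2l leq_add2l.
  case: (posnP (n %% p)%N) => [->|r0]; first by rewrite !mul0n add0n p_gt0.
  by rewrite mul1n -{1}[p]add0n ltn_add2r r0 ltnW.
- by apply/allP=> b /s1 ->.
- rewrite count_s; apply/esym/floor_def.
  rewrite ler_pdivlMr // ltr_pdivrMr // intrD -!pmulrn -natrD -!natrM.
  by rewrite ler_nat ltr_nat leq_divM addn1 ltn_ceil.
Qed.
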